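(* Let $p\ge 1$ be an integer and let $F(z)=\prod_{k=1}^{p}G_{k}(z)^{|z|^{2(k-1)}}$ for $z\in\mathbb{D}$, where $G_1,\dots,G_p$ are nonvanishing log-harmonic mappings in $\mathbb{D}$ (that is, $F\in\mathcal{L}_p\mathcal{H}$). Then for all $z\in\mathbb{D}$: (1) $\mathcal{L}[\log F(z)]=\sum_{k=1}^{p}|z|^{2(k-1)}\mathcal{L}[\log G_{k}(z)]$; and (2) for every integer $n\ge 2$, $\mathcal{L}^{n}[\log F(z)]=\sum_{k=1}^{p}|z|^{2(k-1)}\mathcal{L}^{n}[\log G_{k}(z)]$.
   Context: $\mathbb{D}=\{z\in\mathbb{C}:|z|<1\}$. The operator $\mathcal{L}$ acts on complex-valued differentiable mappings by $\mathcal{L}=z\frac{\partial}{\partial z}-\overline{z}\frac{\partial}{\partial\overline{z}}$ (Wirtinger derivatives), and $\mathcal{L}^n$ is its $n$-fold iterate. A nonvanishing log-harmonic mapping $G$ in $\mathbb{D}$ is a nonvanishing solution of $\overline{G_{\overline z}}/\overline{G}=a\,G_z/G$ for some analytic function $a$; such $G$ is of the form $G=g_1\overline{g_2}$ with $g_1,g_2$ nonvanishing analytic functions in $\mathbb{D}$ (take this form as part of the definition). Thus $\log G=\log g_1+\overline{\log g_2}$, for fixed analytic branches of the logarithms, is a harmonic function in $\mathbb{D}$. Powers are defined by $G^{w}=\exp(w\log G)$ and, correspondingly, $\log F(z)=\sum_{k=1}^{p}|z|^{2(k-1)}\log G_k(z)$. $\mathcal{L}_p\mathcal{H}$ is the class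 of all mappings $F(z)=\prod_{k=1}^{p}G_k(z)^{|z|^{2(k-1)}}$ in $\mathbb{D}$ with all $G_k$ nonvanishing log-harmonic in $\mathbb{D}$. *)

(* Defs.v *)
From Stdlib Require Import Reals.
From Coquelicot Require Import Coquelicot Iter.

Open Scope C_scope.

(* Functions on the unit disk are total functions [C -> C], of which only the
   values on [disk] matter.  As [disk] is open, the derivatives below at a point
   of [disk] depend only on those values. *)
Definition disk (z : C) : Prop := (Cmod z < 1)%R.

Definition analytic (f : C -> C) : Prop :=
  forall z0 : C, disk z0 ->
  exists (a : nat -> C) (r : R), (0 < r)%R /\
    forall z : C, (Cmod (z - z0) < r)%R ->
      @is_pseries C_AbsRing C_NormedModule a (z - z0) (f z).

Definition Cexp (z : C) : C :=
  ((exp (Re z) * cos (Im z))%R, (exp (Re z) * sin (Im z))%R).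

(* The partial derivatives f_x and f_y at z = x + iy; like Coquelicot's [Derive],
   they are total and meaningful where the partial derivatives exist. *)
Definition partial_x (f : C -> C) (z : C) : C :=
  (Derive (fun t => Re (f (t, Im z))) (Re z),
   Derive (fun t => Im (f (t, Im z))) (Re z)).

Definition partial_y (f : C -> C) (z : C) : C :=
  (Derive (fun t => Re (f (Re z, t))) (Im z),
   Derive (fun t => Im (f (Re z, t))) (Im z)).

Definition d_z (f : C -> C) (z : C) : C :=
  (partial_x f z - Ci * partial_y f z) / 2.

Definition d_zbar (f : C -> C) (z : C) : C :=
  (partial_x f z + Ci * partial_y f z) / 2.

Definition opL (f : C -> C) (z : C) : C :=
  z * d_z f z - Cconj z * d_zbar f z.

Definition nonvanishing (f : C -> C) : Prop :=
  forall z : C, disk z -> f z <> 0.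

Definition log_harmonic_factors (G g1 g2 : C -> C) : Prop :=
  analytic g1 /\ nonvanishing g1 /\
  analytic g2 /\ nonvanishing g2 /\
  forall z : C, disk z -> G z = g1 z * Cconj (g2 z).

Definition nonvanishing_log_harmonic (G : C -> C) : Prop :=
  nonvanishing G /\
  (exists a : C -> C, analytic a /\
     forall z : C, disk z ->
       Cconj (d_zbar G z) / Cconj (G z) = a z * (d_z G z / G z)) /\
  exists g1 g2 : C -> C, log_harmonic_factors G g1 g2.

Definition analytic_log_branch (g l : C -> C) : Prop :=
  analytic l /\ forall z : C, disk z -> Cexp (l z) = g z.

(* [logG] is a logarithm log g1 + conj (log g2) of G = g1 * conj g2, for some
   choice of g1, g2 and of the analytic branches log g1, log g2. *)
Definition log_harmonic_log (G logG : C -> C) : Prop :=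
  exists g1 g2 l1 l2 : C -> C,
    log_harmonic_factors G g1 g2 /\
    analytic_log_branch g1 l1 /\ analytic_log_branch g2 l2 /\
    forall z : C, disk z -> logG z = l1 z + Cconj (l2 z).

(* The power G^w, as determined by the chosen value [logG] of log G. *)
Definition pow_of_log (logG w : C) : C := Cexp (w * logG).

Definition Csum (m n : nat) (u : nat -> C) : C :=
  @sum_n_m C_AbelianMonoid u m n.

Definition Cprod (m n : nat) (u : nat -> C) : C :=
  iter_nat Cmult 1 u m n.

(* |z|^(2(k-1)), for k >= 1. *)
Definition weight (k : nat) (z : C) : C :=
  RtoC (Cmod z ^ (2 * (k - 1))).

(* Main.v *)
(** In real terms L = -i (x d/dy - y d/dx) = -i d/dtheta, a derivation which
    annihilates the radial weights |z|^(2(k-1)); hence L commutes with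
    multiplication by the weights, wherever the partial derivatives exist.
    They exist for all iterates: if l1, l2 are analytic, then
    L (l1 + conj l2) = z l1' + conj (- z l2') is again of this form.
    The analyticity of l' needs termwise differentiation of complex power
    series, which follows from |(w+h)^n - w^n - n h w^(n-1)| <=
    n (n-1) s^(n-2) |h|^2 for |w|, |w+h| <= s. *)

Require Import Defs.
From Stdlib Require Import Reals Lra Lia.
From Coquelicot Require Import Coquelicot.

Open Scope C_scope.

(** * Quadratic differentiability and the binomial remainder *)

(** A quadratic error instead of o(h): power series give it with an explicit constant, and it
    restricts to real and imaginary increments without any limit in C. *)
Definition complex_derivative (f : C -> C) (z d : C) : Prop :=
  exists K delta : R, (0 < delta)%R /\
    forall h : C, (Cmod h < delta)%R ->
      (Cmod (f (z + h) - f z - h * d)%C <= K * Cmod h ^ 2)%R.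

(** The quotient ((w+h)^n - w^n - n h w^(n-1)) / h^2, given by a division-free recursion that also
    covers h = 0. *)
Fixpoint binomial_remainder (w h : C) (n : nat) : C :=
  match n with
  | O => 0
  | S m => INR m * Cpow w (pred m) + binomial_remainder w h m * (w + h)
  end.

Lemma Cpow_plus_expansion (w h : C) (n : nat) :
  Cpow (w + h) n =
  Cpow w n + h * (INR n * Cpow w (pred n)) + h * h * binomial_remainder w h n.
Proof.
induction n as [|n IH].
- simpl; ring.
- change (Cpow (w + h) (S n)) with ((w + h) * Cpow (w + h) n).
  rewrite IH, S_INR, RtoC_plus.
  (* The identity w * w^(pred n) = w^n fails at n = 0; there the factor n = 0 saves the formula. *)
  destruct n as [|n]; [simpl; ring|].
  simpl Nat.pred.
  change (binomial_remainder w h (S (S n))) with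
    (INR (S n) * Cpow w n + binomial_remainder w h (S n) * (w + h)).
  change (Cpow w (S (S n))) with (w * (w * Cpow w n)).
  change (Cpow w (S n)) with (w * Cpow w n).
  ring.
Qed.

(** Induction along the recursion, as (n+2) + (n+2)(n+1) <= (n+3)(n+2). The remainders of index 0
    and 1 vanish; starting at 2 avoids truncated subtraction in the exponent of s. *)
Lemma Cmod_binomial_remainder_le (w h : C) (s : R) (n : nat) :
  (Cmod w <= s)%R -> (Cmod (w + h)%C <= s)%R ->
  (Cmod (binomial_remainder w h (S (S n))) <= INR (S (S n)) * INR (S n) * s ^ n)%R.
Proof.
intros Hw Hwh.
assert (Hs : (0 <= s)%R) by (apply Rle_trans with (2 := Hw); apply Cmod_ge_0).
induction n as [|n IH].
- simpl. replace (_ + _) with (RtoC 1) by ring. rewrite Cmod_1. lra.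
- change (binomial_remainder w h (S (S (S n)))) with
    (INR (S (S n)) * Cpow w (S n) + binomial_remainder w h (S (S n)) * (w + h)).
  eapply Rle_trans; [apply Cmod_triangle|].
  rewrite !Cmod_mult, Cmod_R, Cmod_pow, Rabs_pos_eq by apply pos_INR.
  assert (H1 : (INR (S (S n)) * Cmod w ^ S n <= INR (S (S n)) * s ^ S n)%R).
  { apply Rmult_le_compat_l; [apply pos_INR|].
    apply pow_incr; split; [apply Cmod_ge_0 | exact Hw]. }
  assert (H2 : (Cmod (binomial_remainder w h (S (S n))) * Cmod (w + h)%C <=
     INR (S (S n)) * INR (S n) * s ^ n * s)%R).
  { apply Rmult_le_compat; auto using Cmod_ge_0. }
  assert (H3 : (0 <= INR (S (S n)) * s ^ S n)%R)
    by (apply Rmult_le_pos; [apply pos_INR | apply pow_le; exact Hs]).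
  rewrite (S_INR (S (S n))).
  simpl pow in *. rewrite (S_INR (S n)) in *. rewrite S_INR in *. nra.
Qed.

(** * Complex series and their real majorants *)

Lemma Cmod_series_le (u : nat -> C) (b : nat -> R) (l : C) (B : R) :
  (forall n, Cmod (u n) <= b n)%R ->
  @is_series C_AbsRing C_NormedModule u l -> is_series b B ->
  (Cmod l <= B)%R.
Proof.
intros Hub Hu Hb.
assert (Hl : is_lim_seq (fun n => Cmod (sum_n u n)) (Cmod l)).
{ apply (filterlim_comp _ _ _ (fun n => sum_n u n) Cmod _ _ _ Hu).
  apply (@filterlim_norm C_AbsRing C_NormedModule l). }
apply (is_lim_seq_le (fun n => Cmod (sum_n u n)) (sum_n b) (Cmod l) B); auto.
intros n. eapply Rle_trans.
- apply (@norm_sum_n_m C_AbsRing C_NormedModule).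
- apply sum_n_m_le. exact Hub.
Qed.

Definition Cderive_coeff (a : nat -> C) (n : nat) : C := INR (S n) * a (S n).

Lemma pow_n_Cpow (z : C) (n : nat) : @pow_n C_AbsRing z n = Cpow z n.
Proof. induction n as [|n IH]; [reflexivity | simpl; now rewrite IH]. Qed.

Lemma is_Cpseries_series (a : nat -> C) (w l : C) :
  @is_pseries C_AbsRing C_NormedModule a w l <->
  @is_series C_AbsRing C_NormedModule (fun n => Cpow w n * a n) l.
Proof.
assert (E : forall n, @pow_n C_AbsRing w n * a n = Cpow w n * a n)
  by (intros n; now rewrite pow_n_Cpow).
split; apply is_series_ext; intros n; [|symmetry]; exact (E n).
Qed.

(** Each term of a convergent series is a difference of two bounded partial sums, hence bounded by
    2M; the radius is the supremum of the points with bounded terms. This opens the way to the real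
    theory of power series for the coefficients |a_n|. *)
Lemma CV_radius_Cmod_ge (a : nat -> C) (w l : C) :
  @is_pseries C_AbsRing C_NormedModule a w l ->
  Rbar_le (Cmod w) (CV_radius (fun n => Cmod (a n))).
Proof.
intros H. apply (proj1 (is_Cpseries_series _ _ _)) in H.
destruct (CV_radius_bounded (fun n => Cmod (a n))) as [Hub _].
apply Hub.
destruct (@filterlim_bounded C_AbsRing C_NormedModule _ (ex_intro _ l H)) as [M HM].
change (forall n, Cmod (sum_n (fun k => (Cpow w k * a k)%C) n) <= M)%R in HM.
exists (M + M)%R. intros n.
rewrite Rabs_mult, <- RPow_abs, !(Rabs_pos_eq (Cmod _)) by apply Cmod_ge_0.
replace (Cmod (a n) * Cmod w ^ n)%R with (Cmod (Cpow w n * a n))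
  by (rewrite Cmod_mult, Cmod_pow; ring).
destruct n as [|n].
- specialize (HM 0%nat). rewrite sum_O in HM.
  assert (H0 := Cmod_ge_0 (Cpow w 0 * a 0%nat)). lra.
- assert (H1 := HM n). assert (H2 := HM (S n)).
  rewrite (@sum_Sn C_AbelianMonoid) in H2.
  set (S1 := sum_n _ n) in *.
  change (Cmod (S1 + Cpow w (S n) * a (S n)) <= M)%R in H2.
  replace (Cpow w (S n) * a (S n)) with ((S1 + Cpow w (S n) * a (S n)) + - S1) by ring.
  eapply Rle_trans; [apply Cmod_triangle|]. rewrite Cmod_opp. lra.
Qed.

Lemma ex_Cseries_le (u : nat -> C) (b : nat -> R) :
  (forall n, Cmod (u n) <= b n)%R -> ex_series b ->
  exists l : C, @is_series C_AbsRing C_NormedModule u l.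
Proof.
intros Hub Hb.
destruct (@ex_series_le C_AbsRing C_CompleteNormedModule u b Hub Hb) as [l Hl].
exists l. exact Hl.
Qed.

(** * Termwise differentiation of complex power series *)

(** Each power is expanded by [Cpow_plus_expansion]. The terms of index 0 and 1 vanish, and dropping
    them aligns the series with [Cmod_binomial_remainder_le]. *)
Lemma Cderive_series_remainder (a : nat -> C) (w h : C) (fw fwh g : C) :
  @is_pseries C_AbsRing C_NormedModule a w fw ->
  @is_pseries C_AbsRing C_NormedModule a (w + h) fwh ->
  @is_pseries C_AbsRing C_NormedModule (Cderive_coeff a) w g ->
  @is_series C_AbsRing C_NormedModule
    (fun n => h * h * binomial_remainder w h (S (S n)) * a (S (S n)))
    (fwh - fw - h * g).
Proof.
rewrite !is_Cpseries_series. intros Hw Hwh Hg.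
(* The derivative series is reindexed to match the other two, with the extra term 0 at n = 0. *)
assert (Hd : @is_series C_AbsRing C_NormedModule
   (fun n => INR n * Cpow w (pred n) * a n) g).
{ apply (@is_series_decr_1 C_AbsRing C_NormedModule).
  assert (E : g = g + - (INR 0 * Cpow w 0 * a 0%nat)) by (simpl INR; ring).
  refine (eq_ind _ _ _ _ E).
  revert Hg. apply is_series_ext. intros n.
  change (Cpow w n * (INR (S n) * a (S n)) = INR (S n) * Cpow w n * a (S n) :> C).
  ring. }
assert (He := is_series_minus _ _ _ _ (is_series_minus _ _ _ _ Hwh Hw)
                (is_series_scal h _ _ Hd)).
change (is_series (fun n => Cpow (w + h) n * a n - Cpow w n * a n -
   h * (INR n * Cpow w (pred n) * a n)) (fwh - fw - h * g)) in He.
assert (He' : is_series (fun n => h * h * binomial_remainder w h n * a n)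
   (fwh - fw - h * g)).
{ revert He. apply is_series_ext. intros n.
  rewrite Cpow_plus_expansion. match goal with |- ?x = ?y => change (@eq C x y) end. ring. }
apply (is_series_incr_1 (fun n => h * h * binomial_remainder w h (S n) * a (S n))).
apply (is_series_incr_1 (fun n => h * h * binomial_remainder w h n * a n)).
replace (plus _ _) with (fwh - fw - h * g); [exact He'|].
change (fwh - fw - h * g = (fwh - fw - h * g + h * h * (INR 0 * Cpow w 0 + 0 * (w + h)) * a 1%nat) + h * h * 0 * a 0%nat).
simpl; ring.
Qed.

(** The remainder series is dominated by |h|^2 times the second derivative of the series with
    coefficients |a_n|, taken at a radius s slightly above |w|. *)
Lemma Cpseries_complex_derivative (a : nat -> C) (f : C -> C) (r : R) (w : C) :
  (forall z : C, (Cmod z < r)%R -> @is_pseries C_AbsRing C_NormedModule a z (f z)) ->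
  (Cmod w < r)%R ->
  exists d : C, complex_derivative f w d /\
    @is_pseries C_AbsRing C_NormedModule (Cderive_coeff a) w d.
Proof.
intros Hf Hw.
assert (Hw0 := Cmod_ge_0 w).
(* Two radii between |w| and r: convergence at t puts s strictly inside the radius of convergence,
   and s leaves room for w + h. *)
set (s := ((2 * Cmod w + r) / 3)%R). set (t := ((Cmod w + 2 * r) / 3)%R).
assert (Hs : (Cmod w < s < t)%R) by (unfold s, t; lra).
assert (Ht : (t < r)%R) by (unfold t; lra).
set (b := fun n => Cmod (a n)).
assert (Hrad : Rbar_lt (Rabs s) (CV_radius b)).
{ rewrite Rabs_pos_eq by lra.
  apply Rbar_lt_le_trans with t; [simpl; lra|].
  replace t with (Cmod t) by (rewrite Cmod_R; apply Rabs_pos_eq; lra).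
  apply CV_radius_Cmod_ge with (f t). apply Hf.
  rewrite Cmod_R, Rabs_pos_eq; lra. }
assert (Hrad1 : Rbar_lt (Rabs s) (CV_radius (PS_derive b)))
  by now rewrite CV_radius_derive.
assert (Hrad2 : Rbar_lt (Rabs s) (CV_radius (PS_derive (PS_derive b))))
  by now rewrite CV_radius_derive.
assert (H1 := CV_disk_inside _ _ Hrad1).
(* K is the sum of (n+2)(n+1) |a_(n+2)| s^n. *)
destruct (CV_disk_inside _ _ Hrad2) as [K HK].
(* The derivative series at w converges by comparison with its majorant at s. *)
destruct (fun Hle => ex_Cseries_le (fun n => Cpow w n * Cderive_coeff a n) _ Hle H1)
  as [d Hd].
{ intros n. unfold Cderive_coeff, PS_derive, b.
  rewrite !Cmod_mult, Cmod_R, Cmod_pow, !Rabs_mult.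
  rewrite (Rabs_pos_eq (Cmod _)) by apply Cmod_ge_0.
  rewrite (Rmult_comm (_ ^ _)). apply Rmult_le_compat_l.
  - apply Rmult_le_pos; [apply Rabs_pos | apply Cmod_ge_0].
  - rewrite <- RPow_abs. apply pow_incr. rewrite (Rabs_pos_eq s); lra. }
apply (proj2 (is_Cpseries_series _ _ _)) in Hd.
exists d; split; [|exact Hd].
exists K, (s - Cmod w)%R; split; [lra|]. intros h Hh.
assert (Hwh : (Cmod (w + h)%C <= s)%R).
{ eapply Rle_trans; [apply Cmod_triangle|]. lra. }
assert (HE := Cderive_series_remainder a w h _ _ _ (Hf w Hw)
  (Hf (w + h) (Rle_lt_trans _ _ _ Hwh (Rlt_trans _ _ _ (proj2 Hs) Ht))) Hd).
rewrite Rmult_comm.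
apply (Cmod_series_le _ _ _ _) with (2 := HE)
  (3 := is_series_scal_l (Cmod h ^ 2)%R _ _ HK).
intros n. unfold PS_derive, b.
change (scal ?x ?y) with (x * y)%R.
rewrite !Cmod_mult.
assert (Hq := Cmod_binomial_remainder_le w h s n (Rlt_le _ _ (proj1 Hs)) Hwh).
rewrite Rabs_pos_eq.
2: { repeat apply Rmult_le_pos; try apply pos_INR; try apply Cmod_ge_0.
     apply pow_le; lra. }
replace (Cmod h * Cmod h * Cmod (binomial_remainder w h (S (S n))) * Cmod (a (S (S n))))%R
  with ((Cmod h ^ 2 * Cmod (a (S (S n)))) * Cmod (binomial_remainder w h (S (S n))))%R
  by ring.
eapply Rle_trans; [apply Rmult_le_compat_l; [|exact Hq]|].
- apply Rmult_le_pos; [apply pow2_ge_0 | apply Cmod_ge_0].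
- apply Req_le. ring.
Qed.

(** * From complex derivatives to real partial derivatives *)

Lemma is_derive_quadratic (u : R -> R) (x l K delta : R) :
  (0 < delta)%R ->
  (forall t : R, (Rabs t < delta)%R ->
     (Rabs (u (x + t) - u x - t * l) <= K * t ^ 2)%R) ->
  is_derive u x l.
Proof.
intros Hdelta Hu. apply is_derive_Reals. intros eps Heps.
(* The [+ 1] keeps the divisor positive when K = 0. *)
assert (Hpos : (0 < eps / (Rabs K + 1))%R).
{ apply Rdiv_lt_0_compat; [exact Heps|]. assert (H := Rabs_pos K). lra. }
assert (Hmin : (0 < Rmin delta (eps / (Rabs K + 1)))%R) by now apply Rmin_pos.
exists (mkposreal _ Hmin). intros t Ht Htd. simpl in Htd.
assert (Htd1 := Rlt_le_trans _ _ _ Htd (Rmin_l _ _)).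
assert (Htd2 := Rlt_le_trans _ _ _ Htd (Rmin_r _ _)).
specialize (Hu t Htd1).
replace ((u (x + t) - u x) / t - l)%R with ((u (x + t) - u x - t * l) / t)%R
  by (field; exact Ht).
assert (Hat : (0 < Rabs t)%R) by now apply Rabs_pos_lt.
unfold Rdiv. rewrite Rabs_mult, Rabs_inv.
apply Rmult_lt_reg_r with (Rabs t); [exact Hat|].
rewrite Rmult_assoc, Rinv_l, Rmult_1_r by lra.
eapply Rle_lt_trans; [exact Hu|].
rewrite <- (pow2_abs t).
assert (HK := Rle_abs K). assert (HK0 := Rabs_pos K).
assert (H : (Rabs t * (Rabs K + 1) < eps)%R).
{ apply Rmult_lt_compat_r with (r := (Rabs K + 1)%R) in Htd2; [|lra].
  unfold Rdiv in Htd2. rewrite Rmult_assoc, Rinv_l, Rmult_1_r in Htd2; lra. }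
nra.
Qed.

Lemma Rabs_Im_le_Cmod (z : C) : (Rabs (Im z) <= Cmod z)%R.
Proof.
rewrite <- (Rabs_pos_eq (Cmod z)) by apply Cmod_ge_0.
apply Rsqr_le_abs_0. rewrite !Rsqr_pow2, Cmod2_alt.
assert (H := pow2_ge_0 (Re z)). lra.
Qed.

(** Relational companion of [partial_x] and [partial_y]: it records the existence of the
    derivatives, which the total [Derive] hides. *)
Definition is_partials (f : C -> C) (z fx fy : C) : Prop :=
  is_derive (fun t => Re (f (t, Im z))) (Re z) (Re fx) /\
  is_derive (fun t => Im (f (t, Im z))) (Re z) (Im fx) /\
  is_derive (fun t => Re (f (Re z, t))) (Im z) (Re fy) /\
  is_derive (fun t => Im (f (Re z, t))) (Im z) (Im fy).

(** The increments h = t and h = i t both have modulus |t|, so the quadratic bound restricts to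
    either axis; the outcome f_y = i f_x is the Cauchy-Riemann equation. *)
Lemma complex_derivative_is_partials (f : C -> C) (z d : C) :
  complex_derivative f z d -> is_partials f z d (Ci * d).
Proof.
intros (K & delta & Hdelta & Hf).
assert (Hx : forall t : R, (Rabs t < delta)%R ->
   (Cmod (f ((Re z + t)%R, Im z) - f (Re z, Im z) - t * d)%C <= K * t ^ 2)%R).
{ intros t Ht. rewrite <- (pow2_abs t), <- Cmod_R. rewrite <- Cmod_R in Ht.
  replace ((Re z + t)%R, Im z) with (z + t)
    by (destruct z; unfold Cplus, RtoC; simpl; f_equal; ring).
  rewrite <- surjective_pairing. now apply Hf. }
assert (Hy : forall t : R, (Rabs t < delta)%R ->
   (Cmod (f (Re z, (Im z + t)%R) - f (Re z, Im z) - t * (Ci * d))%C <= K * t ^ 2)%R).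
{ intros t Ht.
  assert (E : Cmod (t * Ci) = Rabs t)
    by (rewrite Cmod_mult, Cmod_R, Cmod_Ci; ring).
  rewrite <- (pow2_abs t), <- E. rewrite <- E in Ht.
  replace (Re z, (Im z + t)%R) with (z + t * Ci)
    by (destruct z; unfold Cplus, Cmult, Ci, RtoC; simpl; f_equal; ring).
  rewrite Cmult_assoc, <- surjective_pairing. now apply Hf. }
split; [|split; [|split]];
  refine (is_derive_quadratic _ _ _ K delta Hdelta _); intros t Ht;
  [specialize (Hx t Ht) | specialize (Hx t Ht) | specialize (Hy t Ht) | specialize (Hy t Ht)];
  (eapply Rle_trans; [|eassumption]);
  [eapply Rle_trans; [|apply re_le_Cmod] | eapply Rle_trans; [|apply Rabs_Im_le_Cmod]
  |eapply Rle_trans; [|apply re_le_Cmod] | eapply Rle_trans; [|apply Rabs_Im_le_Cmod]];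
  apply Req_le; f_equal; unfold Re, Im; simpl; ring.
Qed.

Lemma partial_x_unique (f : C -> C) (z fx fy : C) :
  is_partials f z fx fy -> partial_x f z = fx.
Proof.
intros (H1 & H2 & _). apply injective_projections.
- exact (is_derive_unique _ _ _ H1).
- exact (is_derive_unique _ _ _ H2).
Qed.

Lemma partial_y_unique (f : C -> C) (z fx fy : C) :
  is_partials f z fx fy -> partial_y f z = fy.
Proof.
intros (_ & _ & H1 & H2). apply injective_projections.
- exact (is_derive_unique _ _ _ H1).
- exact (is_derive_unique _ _ _ H2).
Qed.

(** * The operator L and the calculus of partial derivatives *)

Lemma opL_eq (f : C -> C) (z : C) :
  opL f z = - Ci * (Re z * partial_y f z - Im z * partial_x f z).
Proof.
unfold opL, d_z, d_zbar.
generalize (partial_x f z) (partial_y f z). intros [a b] [c d].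
destruct z as [x y].
unfold Cconj, Cminus, Cdiv, Cplus, Cmult, Copp, Cinv, Ci, RtoC; simpl.
f_equal; field.
Qed.

Lemma opL_is_partials (f : C -> C) (z fx fy : C) :
  is_partials f z fx fy -> opL f z = - Ci * (Re z * fy - Im z * fx).
Proof.
intros H.
now rewrite opL_eq, (partial_x_unique _ _ _ _ H), (partial_y_unique _ _ _ _ H).
Qed.

(** Written as x^2 + y^2 < 1, membership is an open condition in each coordinate by continuity.
    Equality on [disk] thus carries over to partial derivatives. *)
Lemma disk_locally (z : C) : disk z ->
  locally (Re z) (fun t => disk (t, Im z)) /\ locally (Im z) (fun t => disk (Re z, t)).
Proof.
assert (Hlt : forall w : C, disk w <-> (Re w ^ 2 + Im w ^ 2 < 1)%R).
{ intros w. rewrite <- Cmod2_alt. unfold disk. assert (H := Cmod_ge_0 w). split; nra. }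
rewrite Hlt. intros Hz.
assert (Hc : forall x c : R, (x ^ 2 + c < 1)%R -> locally x (fun t => (t ^ 2 + c < 1)%R)).
{ intros x c Hx.
  apply (open_comp (fun t => t ^ 2 + c)%R (fun u => u < 1)%R) with (2 := open_lt 1);
    [|exact Hx].
  intros t _. apply (ex_derive_continuous (fun t => t ^ 2 + c)%R). auto_derive. exact I. }
split.
- generalize (Hc (Re z) (Im z ^ 2)%R Hz). apply filter_imp.
  intros t Ht. apply Hlt. exact Ht.
- rewrite Rplus_comm in Hz. generalize (Hc (Im z) (Re z ^ 2)%R Hz). apply filter_imp.
  intros t Ht. apply Hlt. simpl Re. simpl Im. rewrite Rplus_comm. exact Ht.
Qed.

Lemma is_partials_ext (f g : C -> C) (z fx fy : C) :
  (forall w, disk w -> f w = g w) -> disk z ->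
  is_partials f z fx fy -> is_partials g z fx fy.
Proof.
intros Hfg Hz (H1 & H2 & H3 & H4).
destruct (disk_locally z Hz) as [Hx Hy].
split; [|split; [|split]];
  first [apply (is_derive_ext_loc _ _ _ _) with (2 := H1)
        |apply (is_derive_ext_loc _ _ _ _) with (2 := H2)
        |apply (is_derive_ext_loc _ _ _ _) with (2 := H3)
        |apply (is_derive_ext_loc _ _ _ _) with (2 := H4)];
  first [revert Hx; apply filter_imp | revert Hy; apply filter_imp];
  intros t Ht; now rewrite Hfg.
Qed.

Lemma is_partials_plus (f g : C -> C) (z fx fy gx gy : C) :
  is_partials f z fx fy -> is_partials g z gx gy ->
  is_partials (fun w => f w + g w) z (fx + gx) (fy + gy).
Proof.
intros (H1 & H2 & H3 & H4) (H1' & H2' & H3' & H4').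
split; [|split; [|split]];
  [exact (is_derive_plus _ _ _ _ _ H1 H1') | exact (is_derive_plus _ _ _ _ _ H2 H2')
  |exact (is_derive_plus _ _ _ _ _ H3 H3') | exact (is_derive_plus _ _ _ _ _ H4 H4')].
Qed.

Lemma is_partials_conj (f : C -> C) (z fx fy : C) :
  is_partials f z fx fy ->
  is_partials (fun w => Cconj (f w)) z (Cconj fx) (Cconj fy).
Proof.
intros (H1 & H2 & H3 & H4).
split; [exact H1|split; [|split; [exact H3|]]];
  [exact (is_derive_opp _ _ _ H2) | exact (is_derive_opp _ _ _ H4)].
Qed.

(** Stated along one real variable, so as to serve the horizontal and the vertical line alike. *)
Lemma is_derive_Cmult (u v a b : R -> R) (x u' v' a' b' : R) :
  is_derive u x u' -> is_derive v x v' -> is_derive a x a' -> is_derive b x b' ->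
  is_derive (fun t => Re ((u t, v t) * (a t, b t))) x
    (Re ((u x, v x) * (a', b') + (u', v') * (a x, b x))) /\
  is_derive (fun t => Im ((u t, v t) * (a t, b t))) x
    (Im ((u x, v x) * (a', b') + (u', v') * (a x, b x))).
Proof.
intros Hu Hv Ha Hb.
assert (E1 := is_derive_mult _ _ _ _ _ Hu Ha Rmult_comm).
assert (E2 := is_derive_mult _ _ _ _ _ Hv Hb Rmult_comm).
assert (E3 := is_derive_mult _ _ _ _ _ Hu Hb Rmult_comm).
assert (E4 := is_derive_mult _ _ _ _ _ Hv Ha Rmult_comm).
split.
- evar_last; [exact (is_derive_minus _ _ _ _ _ E1 E2)|].
  unfold minus, plus, opp, mult; simpl. ring.
- evar_last; [exact (is_derive_plus _ _ _ _ _ E3 E4)|].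
  unfold plus, mult; simpl. ring.
Qed.

Lemma is_partials_mult (f g : C -> C) (z fx fy gx gy : C) :
  is_partials f z fx fy -> is_partials g z gx gy ->
  is_partials (fun w => f w * g w) z (f z * gx + fx * g z) (f z * gy + fy * g z).
Proof.
intros (H1 & H2 & H3 & H4) (H1' & H2' & H3' & H4').
destruct (is_derive_Cmult _ _ _ _ _ _ _ _ _ H1 H2 H1' H2') as [H5 H6].
destruct (is_derive_Cmult _ _ _ _ _ _ _ _ _ H3 H4 H3' H4') as [H7 H8].
rewrite <- !surjective_pairing in H5, H6, H7, H8.
split; [|split; [|split]]; assumption.
Qed.

(** * Radial weights and weighted sums *)

(** As (x^2 + y^2)^(k-1) the weight is a polynomial in x and y, hence differentiable at the origin
    too. *)
Lemma weight_is_partials (k : nat) (z : C) :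
  exists c : R, is_partials (weight k) z (c * Re z)%R (c * Im z)%R.
Proof.
assert (E : forall w, weight k w = RtoC ((Re w ^ 2 + Im w ^ 2) ^ (k - 1))).
{ intros w. unfold weight. now rewrite pow_mult, Cmod2_alt. }
(* For k <= 1 the factor [INR (k - 1)] is 0, so the truncated exponent does no harm. *)
exists (INR (k - 1) * (Re z ^ 2 + Im z ^ 2) ^ pred (k - 1) * 2)%R.
unfold is_partials.
split; [|split; [|split]];
  (eapply is_derive_ext; [intros t; rewrite E; reflexivity|]);
  simpl Re; simpl Im; auto_derive; trivial; simpl; ring.
Qed.

(* The gradient of the weight at z is a multiple of z, so L kills the weight. *)
Lemma opL_weight_mult (k : nat) (f : C -> C) (z fx fy : C) :
  is_partials f z fx fy ->
  exists gx gy, is_partials (fun w => weight k w * f w) z gx gy /\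
    - Ci * (Re z * gy - Im z * gx) = weight k z * opL f z.
Proof.
intros Hf. destruct (weight_is_partials k z) as [c Hc].
eexists; eexists; split; [exact (is_partials_mult _ _ _ _ _ _ _ Hc Hf)|].
rewrite (opL_is_partials _ _ _ _ Hf), !RtoC_mult. ring.
Qed.

(* The witnesses gx, gy are given because the identity must be transported to a
   function that agrees with the sum on the disk only. *)
Lemma opL_weighted_sum (p : nat) (f : nat -> C -> C) (z : C) :
  (forall k, (1 <= k <= p)%nat -> exists fx fy, is_partials (f k) z fx fy) ->
  exists gx gy, is_partials (fun w => Csum 1 p (fun k => weight k w * f k w)) z gx gy /\
    - Ci * (Re z * gy - Im z * gx) = Csum 1 p (fun k => weight k z * opL (f k) z).
Proof.
induction p as [|p IH]; intros Hf.
- exists 0, 0. split; [|change (Csum 1 0 _) with (RtoC 0); ring].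
  split; [|split; [|split]]; exact (is_derive_const 0%R _).
- destruct IH as (gx & gy & Hg & Eg); [intros k Hk; apply Hf; lia|].
  destruct (Hf (S p)) as (fx & fy & Hfp); [lia|].
  destruct (opL_weight_mult (S p) _ _ _ _ Hfp) as (hx & hy & Hh & Eh).
  exists (gx + hx), (gy + hy).
  assert (E : forall u, Csum 1 (S p) u = Csum 1 p u + u (S p))
    by (intros u; apply (@sum_n_Sm C_AbelianMonoid); lia).
  split.
  + assert (Hs := is_partials_plus _ _ _ _ _ _ _ Hg Hh).
    destruct Hs as (H1 & H2 & H3 & H4).
    split; [|split; [|split]]; (eapply is_derive_ext; [intros t; rewrite E; reflexivity|]);
      assumption.
  + rewrite E, <- Eg, <- Eh. ring.
Qed.

(** * Analytic functions, and harmonic functions under L *)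

(** For analytic f, [partial_x f] is the complex derivative f' and serves as its name below. The
    proof differentiates the expansion about z at its centre. *)
Lemma analytic_is_partials (f : C -> C) (z : C) :
  analytic f -> disk z -> is_partials f z (partial_x f z) (Ci * partial_x f z).
Proof.
intros Hf Hz. destruct (Hf z Hz) as (a & r & Hr & Ha).
destruct (Cpseries_complex_derivative a (fun w => f (z + w)) r 0) as (d & Hd & _).
- intros w Hw. replace w with (z + w - z) at 1 by ring. apply Ha.
  now replace (z + w - z) with w by ring.
- now rewrite Cmod_0.
- assert (Hd' : complex_derivative f z d).
  { destruct Hd as (K & delta & Hdelta & Hd). exists K, delta; split; [exact Hdelta|].
    intros h Hh. specialize (Hd h Hh). now rewrite Cplus_0_l, Cplus_0_r in Hd. }
  assert (Hp := complex_derivative_is_partials _ _ _ Hd').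
  now rewrite (partial_x_unique _ _ _ _ Hp).
Qed.

(** The differentiated series about z0 represents f' at every z with |z - z0| < r, so the radius r
    is kept. *)
Lemma analytic_partial_x (f : C -> C) : analytic f -> analytic (partial_x f).
Proof.
intros Hf z0 Hz0. destruct (Hf z0 Hz0) as (a & r & Hr & Ha).
exists (Cderive_coeff a), r; split; [exact Hr|]. intros z Hz.
destruct (Cpseries_complex_derivative a (fun w => f (z0 + w)) r (z - z0))
  as (d & Hd & Hs); [|exact Hz|].
- intros w Hw. replace w with (z0 + w - z0) at 1 by ring. apply Ha.
  now replace (z0 + w - z0) with w by ring.
- assert (Hd' : complex_derivative f z d).
  { destruct Hd as (K & delta & Hdelta & Hd). exists K, delta; split; [exact Hdelta|].
    intros h Hh. specialize (Hd h Hh).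
    replace (z0 + (z - z0 + h)) with (z + h) in Hd by ring.
    now replace (z0 + (z - z0)) with z in Hd by ring. }
  now rewrite (partial_x_unique _ _ _ _ (complex_derivative_is_partials _ _ _ Hd')).
Qed.

Lemma analytic_mult_id (c : C) (f : C -> C) :
  analytic f -> analytic (fun z => c * z * f z).
Proof.
intros Hf z0 Hz0. destruct (Hf z0 Hz0) as (a & r & Hr & Ha).
(* From c z = c z0 + c (z - z0); the factor z - z0 shifts the coefficients by one. *)
exists (PS_plus (PS_scal (c * z0) a) (PS_scal c (PS_incr_1 a))), r.
split; [exact Hr|]. intros z Hz. specialize (Ha z Hz).
assert (H := is_pseries_plus _ _ _ _ _
  (is_pseries_scal (c * z0) _ _ _ (Cmult_comm _ _) Ha)
  (is_pseries_scal c _ _ _ (Cmult_comm _ _) (is_pseries_incr_1 _ _ _ Ha))).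
replace (c * z * f z) with (c * z0 * f z + c * ((z - z0) * f z)) by ring.
exact H.
Qed.

(** The invariant of the iteration: it contains every log G_k, is preserved by L, and ensures that
    partial derivatives exist on [disk]. *)
Definition analytic_plus_conj (f : C -> C) : Prop :=
  exists f1 f2 : C -> C, analytic f1 /\ analytic f2 /\
    forall z : C, disk z -> f z = f1 z + Cconj (f2 z).

Lemma analytic_plus_conj_is_partials (f f1 f2 : C -> C) (z : C) :
  analytic f1 -> analytic f2 ->
  (forall w, disk w -> f w = f1 w + Cconj (f2 w)) -> disk z ->
  is_partials f z (partial_x f1 z + Cconj (partial_x f2 z))
    (Ci * partial_x f1 z + Cconj (Ci * partial_x f2 z)).
Proof.
intros H1 H2 Hf Hz.
apply is_partials_ext with (fun w => f1 w + Cconj (f2 w)); [|exact Hz|].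
- intros w Hw. symmetry. now apply Hf.
- apply is_partials_plus; [|apply is_partials_conj]; now apply analytic_is_partials.
Qed.

Lemma opL_analytic_plus_conj (f : C -> C) :
  analytic_plus_conj f -> analytic_plus_conj (opL f).
Proof.
intros (f1 & f2 & H1 & H2 & Hf).
(* The functions z f1' and -z f2', with the constants 1 and -1 spelled out to fit
   [analytic_mult_id]. *)
exists (fun z => 1 * z * partial_x f1 z), (fun z => - (1) * z * partial_x f2 z).
split; [|split]; [now apply analytic_mult_id, analytic_partial_x..|].
intros z Hz.
rewrite (opL_is_partials _ _ _ _ (analytic_plus_conj_is_partials f f1 f2 z H1 H2 Hf Hz)).
generalize (partial_x f1 z) (partial_x f2 z). intros [a b] [c d].
destruct z as [x y].
unfold Cconj, Cplus, Cminus, Cmult, Copp, Ci, RtoC; simpl. f_equal; ring.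
Qed.

Lemma iter_opL_analytic_plus_conj (n : nat) (f : C -> C) :
  analytic_plus_conj f -> analytic_plus_conj (Nat.iter n opL f).
Proof.
intros Hf. induction n as [|n IH]; [exact Hf|].
now apply opL_analytic_plus_conj.
Qed.

(** * Iteration of L on the weighted sum *)

Lemma iter_opL_weighted_sum (p : nat) (logG : nat -> C -> C) (logF : C -> C) (n : nat) :
  (forall k, (1 <= k <= p)%nat -> analytic_plus_conj (logG k)) ->
  (forall z, disk z -> logF z = Csum 1 p (fun k => weight k z * logG k z)) ->
  forall z, disk z ->
    Nat.iter n opL logF z = Csum 1 p (fun k => weight k z * Nat.iter n opL (logG k) z).
Proof.
intros HG HF. induction n as [|n IH]; [exact HF|]. intros z Hz.
destruct (opL_weighted_sum p (fun k => Nat.iter n opL (logG k)) z)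
  as (gx & gy & Hg & Eg).
{ intros k Hk.
  destruct (iter_opL_analytic_plus_conj n _ (HG k Hk)) as (f1 & f2 & H1 & H2 & Hf).
  eexists; eexists; exact (analytic_plus_conj_is_partials _ f1 f2 z H1 H2 Hf Hz). }
(* The n-th iterate on log F agrees with the weighted sum on [disk] by induction, so it inherits the
   partial derivatives gx, gy of the sum at z. *)
simpl Nat.iter. rewrite <- Eg. apply opL_is_partials.
apply is_partials_ext with (3 := Hg); [|exact Hz].
intros w Hw. symmetry. now apply IH.
Qed.

Theorem theorem1 (p : nat) (hp : (1 <= p)%nat)
  (G logG : nat -> C -> C) (F logF : C -> C)
  (hG : forall k : nat, (1 <= k <= p)%nat -> nonvanishing_log_harmonic (G k))
  (hlogG : forall k : nat, (1 <= k <= p)%nat -> log_harmonic_log (G k) (logG k))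
  (hF : forall z : C, disk z ->
     F z = Cprod 1 p (fun k => pow_of_log (logG k z) (weight k z)))
  (hlogF : forall z : C, disk z ->
     logF z = Csum 1 p (fun k => weight k z * logG k z)) :
  (forall z : C, disk z ->
     opL logF z = Csum 1 p (fun k => weight k z * opL (logG k) z))
  /\
  (forall n : nat, (2 <= n)%nat ->
   forall z : C, disk z ->
     Nat.iter n opL logF z =
     Csum 1 p (fun k => weight k z * Nat.iter n opL (logG k) z)).
Proof.
(* The branches of log g1 and log g2 are the two analytic functions required. *)
assert (HG : forall k, (1 <= k <= p)%nat -> analytic_plus_conj (logG k)).
{ intros k Hk.
  destruct (hlogG k Hk) as (g1 & g2 & l1 & l2 & _ & [H1 _] & [H2 _] & H).
  now exists l1, l2. }
split.
- exact (iter_opL_weighted_sum p logG logF 1 HG hlogF).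
- intros n _. exact (iter_opL_weighted_sum p logG logF n HG hlogF).
Qed.
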